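(* Assume the mini-batch partitions satisfy $\tilde{\mathbf a}=\tilde{\mathbf b}=\frac1k\mathbf 1_k$. For all $s,t\in\{1,\dots,k\}$ let $(\mathbf f^{st}_*,\mathbf g^{st}_* )\in\mathbb R^n\times\mathbb R^m$ be an optimal solution of the mini-batch dual problem $$\sup\{\langle\mathbf f,\mathbf a^s\rangle+\langle\mathbf g,\mathbf b^t\rangle:\ \mathbf f\in\mathbb R^n,\ \mathbf g\in\mathbb R^m,\ \mathbf f\oplus\mathbf g\le\mathbf C^{st}\}.$$ For $\mathbf u=(u_1,\dots,u_k)$ and $\mathbf v=(v_1,\dots,v_k)$ in $\mathbb R^k$, define $\tilde{\mathbf f}\in\mathbb R^N$, $\tilde{\mathbf g}\in\mathbb R^M$ block-wise by $$[\tilde{\mathbf f}_i]_{i\in B_x^s}=\mathbf f^{ss}_*+u_s\mathbf 1_n\quad(s=1,\dots,k),\qquad[\tilde{\mathbf g}_j]_{j\in B_y^t}=\mathbf g^{tt}_*+v_t\mathbf 1_m\quad(t=1,\dots,k).$$ Let $\mathbf K\in\mathbb R^{k\times k}$ have entries $K_{s,t}=\min_j[\mathbf g^{st}_*-\mathbf g^{tt}_*]_j-\max_i[\mathbf f^{ss}_*-\mathbf f^{st}_*]_i$. If $\mathbf u\oplus\mathbf v\le\mathbf K$, then $(\tilde{\mathbf f},\tilde{\mathbf g})$ is feasible for the full dual problem $$\sup\{\langle\mathbf f,\mathbf a\rangle+\langle\mathbf g,\mathbf b\rangle:\ \mathbf f\in\mathbb R^N,\ \mathbf g\in\mathbb R^M,\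 \mathbf f\oplus\mathbf g\le\mathbf C\},$$ with objective value $$\langle\tilde{\mathbf f},\mathbf a\rangle+\langle\tilde{\mathbf g},\mathbf b\rangle=\langle\mathbf u,\tilde{\mathbf a}\rangle+\langle\mathbf v,\tilde{\mathbf b}\rangle+\sum_{s=1}^k\tfrac1k\,\mathrm{OT}(\alpha^s,\beta^s).$$
   Context: Let $X_1,\dots,X_N$ and $Y_1,\dots,Y_M$ be points, $c$ a real-valued cost function, and $\mathbf C\in\mathbb R^{N\times M}$ with $\mathbf C_{ij}=c(X_i,Y_j)$. Let $\mathbf a\in\Delta_N$, $\mathbf b\in\Delta_M$ be probability vectors, $\alpha_N=\sum_ia_i\delta_{X_i}$, $\beta_M=\sum_jb_j\delta_{Y_j}$. For vectors $\mathbf p\in\mathbb R^p$, $\mathbf q\in\mathbb R^q$, $\mathbf p\oplus\mathbf q\in\mathbb R^{p\times q}$ is the matrix with entries $(\mathbf p\oplus\mathbf q)_{ij}=p_i+q_j$; matrix inequalities are entrywise. $\mathbf U(\mathbf p,\mathbf q)=\{\mathbf P\in\mathbb R_+^{p\times q}:\mathbf P\mathbf 1_q=\mathbf p,\ \mathbf P^\top\mathbf 1_p=\mathbf q\}$. Mini-batches: $N=nk$, $M=mk$ with $n,m,k$ positive integers. The index set $\{1,\dots,N\}$ is partitioned into $k$ (ordered) subsets $B_x^1,\dots,B_x^k$ of size $n$ and $\{1,\dots,M\}$ into $k$ (ordered) subsets $B_y^1,\dots,B_y^k$ of size $m$. $\mathbf C^{st}\in\mathbb R^{n\times m}$ is the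 submatrix of $\mathbf C$ with rows $B_x^s$ and columns $B_y^t$. The aggregated mini-batch masses are $\tilde{\mathbf a},\tilde{\mathbf b}\in\Delta_k$ with $\tilde{\mathbf a}_s=\sum_{i\in B_x^s}a_i$, $\tilde{\mathbf b}_t=\sum_{j\in B_y^t}b_j$. The normalized batch weights are $\mathbf a^s=\frac1{\tilde{\mathbf a}_s}(a_i)_{i\in B_x^s}\in\Delta_n$ and $\mathbf b^t=\frac1{\tilde{\mathbf b}_t}(b_j)_{j\in B_y^t}\in\Delta_m$, with corresponding normalized discrete measures $\alpha^s,\beta^t$, and $\mathrm{OT}(\alpha^s,\beta^t)=\min_{\mathbf P\in\mathbf U(\mathbf a^s,\mathbf b^t)}\langle\mathbf P,\mathbf C^{st}\rangle$ is the (unregularized) discrete optimal transport cost. *)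

(* Defs.v *)
From HB Require Import structures.
From mathcomp Require Import all_boot all_order all_algebra.
From mathcomp Require Import boolp classical_sets reals.
From mathcomp Require Import topology normedtype derive.

Set Implicit Arguments.
Unset Strict Implicit.
Unset Printing Implicit Defensive.

Import Order.TTheory GRing.Theory Num.Theory.
Import numFieldNormedType.Exports.

Local Open Scope classical_set_scope.
Local Open Scope ring_scope.

(* Vectors are column vectors; [mxdot] is the Frobenius inner product, hence
   the usual inner product when q = 1. *)
Definition mxdot (R : realType) (p q : nat) (A B : 'M[R]_(p, q)) : R :=
  \sum_i \sum_j A i j * B i j.

Definition lemx (R : realType) (p q : nat) (A B : 'M[R]_(p, q)) : Prop :=
  forall i j, A i j <= B i j.

Definition oplus (R : realType) (p q : nat) (f : 'cV[R]_p) (g : 'cV[R]_q) :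
    'M[R]_(p, q) :=
  \matrix_(i, j) (f i 0 + g j 0).

(* The default value of the big operator is an entry of x, so that these are
   genuinely the minimum and the maximum of the entries. *)
Definition vmin (R : realType) (p : nat) (x : 'cV[R]_p.+1) : R :=
  \big[Num.min/x ord0 0]_i x i 0.

Definition vmax (R : realType) (p : nat) (x : 'cV[R]_p.+1) : R :=
  \big[Num.max/x ord0 0]_i x i 0.

Definition simplex (R : realType) (p : nat) : set 'cV[R]_p :=
  [set a | (forall i, 0 <= a i 0) /\ \sum_i a i 0 = 1].

Definition cost_matrix (R : realType) (TX TY : Type) (N M : nat)
    (c : TX -> TY -> R) (X : 'I_N -> TX) (Y : 'I_M -> TY) : 'M[R]_(N, M) :=
  \matrix_(i, j) c (X i) (Y j).

Definition couplings (R : realType) (p q : nat) (a : 'cV[R]_p) (b : 'cV[R]_q) :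
    set 'M[R]_(p, q) :=
  [set P | [/\ lemx 0 P, P *m const_mx 1 = a & P^T *m const_mx 1 = b]].

(* The infimum is a minimum for probability vectors a and b, see
   [OT_attained]. *)
Definition OT (R : realType) (p q : nat) (a : 'cV[R]_p) (b : 'cV[R]_q)
    (C : 'M[R]_(p, q)) : R :=
  inf [set mxdot P C | P in couplings a b].

Definition dual_feasible (R : realType) (p q : nat) (C : 'M[R]_(p, q))
    (f : 'cV[R]_p) (g : 'cV[R]_q) : Prop :=
  lemx (oplus f g) C.

Definition dual_objective (R : realType) (p q : nat) (a : 'cV[R]_p)
    (b : 'cV[R]_q) (f : 'cV[R]_p) (g : 'cV[R]_q) : R :=
  mxdot f a + mxdot g b.

Definition dual_optimal (R : realType) (p q : nat) (a : 'cV[R]_p)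
    (b : 'cV[R]_q) (C : 'M[R]_(p, q)) (f : 'cV[R]_p) (g : 'cV[R]_q) : Prop :=
  dual_feasible C f g /\
  forall f' g', dual_feasible C f' g' ->
    dual_objective a b f' g' <= dual_objective a b f g.

(* A partition of 'I_N into k batches of size n, each batch B s being given
   together with an enumeration of its n elements, which fixes the order of the
   coordinates of the vectors indexed by that batch. *)
Definition batch_partition (N n k : nat) (B : 'I_k -> n.-tuple 'I_N) : Prop :=
  [/\ forall s, uniq (B s),
      forall s t i, i \in B s -> i \in B t -> s = t &
      forall i, exists s, i \in B s].

Section Batches.
Variables (R : realType) (N n k : nat) (B : 'I_k -> n.-tuple 'I_N).

(* (a_i)_{i in B^s} *)
Definition restrict (s : 'I_k) (a : 'cV[R]_N) : 'cV[R]_n :=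
  rowsub (tnth (B s)) a.

Definition batch_mass (a : 'cV[R]_N) : 'cV[R]_k :=
  \col_s \sum_(i in B s) a i 0.

Definition batch_weight (a : 'cV[R]_N) (s : 'I_k) : 'cV[R]_n :=
  (batch_mass a s 0)^-1 *: restrict s a.

(* x is the vector assembled from the blocks h s; it exists and is unique when
   B is a partition, see [blockwise_exists_unique]. *)
Definition blockwise (h : 'I_k -> 'cV[R]_n) (x : 'cV[R]_N) : Prop :=
  forall s, restrict s x = h s.

End Batches.

Definition batch_cost (R : realType) (N M n m k : nat)
    (Bx : 'I_k -> n.-tuple 'I_N) (By : 'I_k -> m.-tuple 'I_M)
    (C : 'M[R]_(N, M)) (s t : 'I_k) : 'M[R]_(n, m) :=
  mxsub (tnth (Bx s)) (tnth (By t)) C.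

(* K_{s,t} = min_j [g^{st} - g^{tt}]_j - max_i [f^{ss} - f^{st}]_i *)
Definition gap_matrix (R : realType) (n m k : nat)
    (f : 'I_k -> 'I_k -> 'cV[R]_n.+1) (g : 'I_k -> 'I_k -> 'cV[R]_m.+1) :
    'M[R]_k :=
  \matrix_(s, t) (vmin (g s t - g t t) - vmax (f s s - f s t)).

Lemma blockwise_exists_unique (R : realType) (N n k : nat)
    (B : 'I_k -> n.-tuple 'I_N) (h : 'I_k -> 'cV[R]_n) :
  batch_partition B -> exists! x, blockwise B h x.
Proof.
move=> [uB dB cB].
pose x : 'cV[R]_N := \col_i \sum_s \sum_(j < n | tnth (B s) j == i) h s j 0.
exists x; split=> [s|y hy].
  apply/matrixP=> j z; rewrite (ord1 z) !mxE (bigD1 s) //= [X in _ + X]big1.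
    rewrite addr0 (big_pred1 j) // => j' /=.
    apply/eqP/eqP => [|->//].
    by move/tuple_uniqP: (uB s); apply.
  move=> t ts; rewrite big1 // => j' /eqP e.
  case/eqP: ts; apply: (dB t s (tnth (B t) j')); rewrite ?mem_tnth//.
  by rewrite e mem_tnth.
have hx : forall s j, y (tnth (B s) j) 0 = h s j 0.
  by move=> s j; rewrite -(hy s) !mxE.
apply/matrixP=> i z; rewrite (ord1 z) !mxE.
have [s /tnthP[j ->]] := cB i.
rewrite (bigD1 s) //= [X in _ + X]big1; last first.
  move=> t ts; rewrite big1 // => j' /eqP e.
  case/eqP: ts; apply: (dB t s (tnth (B t) j')); rewrite ?mem_tnth//.
  by rewrite e mem_tnth.
rewrite addr0 (big_pred1 j) ?hx // => j' /=.
apply/eqP/eqP => [|->//].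
by move/tuple_uniqP: (uB s); apply.
Qed.

Lemma OT_attained (R : realType) (p q : nat) (a : 'cV[R]_p) (b : 'cV[R]_q)
    (C : 'M[R]_(p, q)) :
  simplex a -> simplex b ->
  exists P, [/\ couplings a b P, OT a b C = mxdot P C &
    forall Q, couplings a b Q -> mxdot P C <= mxdot Q C].
Proof.
move=> [a0 a1] [b0 b1].
pose U : set 'rV[R]_(p * q) := [set v | couplings a b (vec_mx v)].
pose F (v : 'rV[R]_(p * q)) := mxdot (vec_mx v) C.
have U0 : U !=set0.
  exists (mxvec (a *m b^T)); rewrite /U /= mxvecK; split.
  - by move=> i j; rewrite mxE mxE big_ord1 !mxE mulr_ge0.
  - rewrite -mulmxA [b^T *m _](_ : _ = 1%:M) ?mulmx1 //.
    apply/matrixP=> i j; rewrite !mxE !ord1 eqxx mulr1n -[RHS]b1.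
    by apply: eq_bigr => k _; rewrite !mxE mulr1.
  - rewrite trmx_mul trmxK -mulmxA [a^T *m _](_ : _ = 1%:M) ?mulmx1 //.
    apply/matrixP=> i j; rewrite !mxE !ord1 eqxx mulr1n -[RHS]a1.
    by apply: eq_bigr => k _; rewrite !mxE mulr1.
have vc i j : continuous (fun v : 'rV[R]_(p * q) => vec_mx v i j).
  under eq_fun do rewrite mxE; exact: coord_continuous.
have sumc (I : finType) (h : I -> 'rV[R]_(p * q) -> R) :
    (forall i, continuous (h i)) -> continuous (fun v => \sum_i h i v).
  move=> ch; apply: continuous_big => [|i _]; last exact: ch.
  exact: add_continuous.
have rowE (P : 'M[R]_(p, q)) i z :
    (P *m (const_mx 1 : 'cV[R]_q)) i z = \sum_j P i j.
  by rewrite mxE; apply: eq_bigr => j _; rewrite mxE mulr1.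
have colE (P : 'M[R]_(p, q)) j z :
    (P^T *m (const_mx 1 : 'cV[R]_p)) j z = \sum_i P i j.
  by rewrite mxE; apply: eq_bigr => i _; rewrite !mxE mulr1.
have UE : U = (\bigcap_i \bigcap_j [set v | 0 <= vec_mx v i j]) `&`
   ((\bigcap_i [set v | \sum_j vec_mx v i j = a i 0]) `&`
   (\bigcap_j [set v | \sum_i vec_mx v i j = b j 0])).
  apply/seteqP; split=> v /=.
    move=> [v0 va vb]; split; [|split].
    - by move=> i _ j _ /=; have := v0 i j; rewrite mxE.
    - by move=> i _ /=; rewrite -va rowE.
    - by move=> j _ /=; rewrite -vb colE.
  move=> [v0 [va vb]]; split.
  - by move=> i j; rewrite mxE; exact: v0.
  - by apply/matrixP=> i z; rewrite rowE ord1; exact: va.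
  - by apply/matrixP=> i z; rewrite colE ord1; exact: vb.
have clU : closed U.
  rewrite UE; apply: closedI; [|apply: closedI].
  - apply: closed_bigI => i _; apply: closed_bigI => j _.
    apply: (@preimage_closed _ _ (fun v : 'rV[R]_(p * q) => vec_mx v i j)
      [set x | 0 <= x]); last exact: closed_ge.
    by move=> v _; exact: vc.
  - apply: closed_bigI => i _.
    apply: (@preimage_closed _ _ (fun v : 'rV[R]_(p * q) =>
      \sum_j vec_mx v i j) [set x | x = a i 0]); last exact: closed_eq.
    by move=> v _; apply: sumc => j; exact: vc.
  - apply: closed_bigI => j _.
    apply: (@preimage_closed _ _ (fun v : 'rV[R]_(p * q) =>
      \sum_i vec_mx v i j) [set x | x = b j 0]); last exact: closed_eq.
    by move=> v _; apply: sumc => i; exact: vc.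
have bdU : bounded_set U.
  exists 1; split=> // M M1 v [v0 va vb].
  rewrite /= [`|v|]mx_normrE; apply: bigmax_le; first exact: le_trans (ltW M1).
  move=> [i j] _ /=; rewrite (ord1 i).
  have [i' [j' ->]] : exists i' j', v 0 j = vec_mx v i' j'.
    by case/mxvec_indexP: j => i' j'; exists i', j'; rewrite mxE.
  have P0 i1 j1 : 0 <= vec_mx v i1 j1 by have := v0 i1 j1; rewrite mxE.
  rewrite ger0_norm //; apply: le_trans (ltW M1).
  have : \sum_j vec_mx v i' j <= 1.
    rewrite -(rowE _ _ 0) va -a1 (bigD1 i') //= lerDl.
    by apply: sumr_ge0 => *; exact: a0.
  apply: le_trans; rewrite (bigD1 j') //= lerDl.
  by apply: sumr_ge0 => *; exact: P0.
have cF : {within U, continuous F}.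
  apply: continuous_subspaceT.
  apply: (sumc _ (fun i v => \sum_j vec_mx v i j * C i j)) => i.
  apply: (sumc _ (fun j v => vec_mx v i j * C i j)) => j v.
  exact: (@cvgMr_tmp _ _ _ _ (fun v => vec_mx v i j) _ _ (vc i j v)).
have [v /set_mem Uv vmin] := EVT_min_rV U0 (bounded_closed_compact bdU clU) cF.
have Pmin Q : couplings a b Q -> F v <= mxdot Q C.
  move=> cQ; rewrite -(mxvecK Q); apply: vmin.
  by rewrite inE /U /= mxvecK.
exists (vec_mx v); split => //; apply/eqP; rewrite eq_le; apply/andP; split.
  apply: ge_inf; last by exists (vec_mx v).
  by exists (F v) => _ [Q cQ <-]; exact: Pmin.
apply: lb_le_inf; first by exists (F v), (vec_mx v).
by move=> _ [Q cQ <-]; exact: Pmin.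
Qed.

(* Main.v *)
(* Weak duality bounds every transport cost from below by the dual objective.
   Conversely, at a dual optimum no direction that is nonpositive on the tight
   constraints increases the objective, so by Farkas' lemma the objective is a
   nonnegative combination of the tight constraints; the coefficients form a
   coupling, whose cost equals the dual value. Hence each OT(alpha^s, beta^s) is
   the value of (f^ss, g^ss), and the objective identity is a sum over blocks.
   Feasibility holds because u (+) v <= K puts (f^ss + u_s) (+) (g^tt + v_t)
   below f^st (+) g^st, hence below C^st. *)
Require Import Defs.
From mathcomp Require Import all_boot all_order all_algebra.
From mathcomp Require Import boolp classical_sets reals.
From mathcomp Require Import ring lra.

Set Implicit Arguments.
Unset Strict Implicit.
Unset Printing Implicit Defensive.

Import Order.TTheory GRing.Theory Num.Theory.

Local Open Scope classical_set_scope.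
Local Open Scope ring_scope.

(** * Farkas' lemma *)

(* Bartl's proof by induction on the number of functionals, which needs no
   topology and no finite dimension. *)
Lemma farkas (R : realFieldType) (W : lmodType R) (I : eqType) (s : seq I)
    (A : I -> W -> R) (b : W -> R) :
  uniq s -> (forall i, scalar (A i)) -> scalar b ->
  (forall y, (forall i, i \in s -> A i y <= 0) -> b y <= 0) ->
  exists x : I -> R,
    (forall i, 0 <= x i) /\ forall y, b y = \sum_(i <- s) x i * A i y.
Proof.
elim: s A b => [|t s IHs] A b.
  move=> _ _ b_lin b_le0; exists (fun=> 0); split=> // y.
  have bN : b (- y) = - b y.
    have b0 : b 0 = 0.
      by have := b_lin 1 0 0; rewrite scale1r addr0 mul1r; lra.
    by have := b_lin (-1) y 0; rewrite scaleN1r addr0 b0 mulN1r addr0.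
  rewrite big_nil; apply/eqP; rewrite eq_le b_le0 //=.
  by rewrite -oppr_le0 -bN b_le0.
move=> /= /andP[tNs s_uniq] A_lin b_lin Ab.
have [Asb|] := pselect (forall y, (forall i, i \in s -> A i y <= 0) -> b y <= 0).
  have [x [x_ge0 bE]] := IHs A b s_uniq A_lin b_lin Asb.
  exists (fun i => if i == t then 0 else x i); split=> [i|y].
    by case: ifP.
  rewrite big_cons eqxx mul0r add0r bE; apply: eq_big_seq => i si.
  by case: eqVneq => // it; rewrite -it si in tNs.
(* The direction [y0] satisfies the constraints in [s] but has [b y0 > 0], so it must violate the
   remaining one, [t]. *)
move=> /existsNP[y0 /not_implyP[Ay0 /negP]]; rewrite -ltNge => by0_gt0.
have Aty0_gt0 : 0 < A t y0.
  rewrite ltNge; apply/negP => Aty0; have : b y0 <= 0.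
    by apply: Ab => i; rewrite inE => /predU1P[->//|]; exact: Ay0.
  by rewrite leNgt by0_gt0.
(* Project onto the kernel of A t along y0. *)
pose r y := A t y / A t y0; pose pr y := - r y *: y0 + y.
have pr_lin (h : W -> R) : scalar h -> scalar (h \o pr).
  move=> h_lin z y1 y2; rewrite /= !h_lin /r A_lin; ring.
have [|z prA|x [x_ge0 bE]] := IHs (fun i => A i \o pr) (b \o pr) s_uniq _
    (pr_lin _ b_lin).
- by move=> i; exact: pr_lin.
- apply: Ab => i; rewrite inE => /predU1P[->|]; last exact: prA.
  by rewrite A_lin /r mulNr divfK ?addNr// gt_eqF.
(* The value of the coefficient of [A t] forced by evaluating the identity at [y0]; its numerator is
   nonnegative since [A i y0 <= 0 < b y0] for [i] in [s]. *)
pose xt := (b y0 - \sum_(i <- s) x i * A i y0) / A t y0.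
exists (fun i => if i == t then xt else x i); split=> [i|y].
  case: ifP => // _; rewrite divr_ge0 ?(ltW Aty0_gt0)// subr_ge0.
  apply: le_trans (ltW by0_gt0); rewrite big_seq sumr_le0// => j sj.
  by rewrite mulr_ge0_le0 ?Ay0.
rewrite big_cons eqxx.
have -> : \sum_(i <- s) (if i == t then xt else x i) * A i y =
          \sum_(i <- s) x i * A i y.
  apply: eq_big_seq => i si.
  by case: eqVneq => // it; rewrite -it si in tNs.
have := bE y; rewrite /= b_lin.
under eq_bigr do rewrite A_lin mulrDr mulrCA.
rewrite big_split /= -mulr_sumr => bEy.
rewrite /xt mulrAC -mulrA -/(r y).
rewrite -[LHS](addKr (- r y * b y0)) bEy; ring.
Qed.

(** * Linear programming duality for discrete transport *)

Lemma mxdot_cv (R : realType) (p : nat) (x y : 'cV[R]_p) :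
  mxdot x y = \sum_i x i 0 * y i 0.
Proof. by apply: eq_bigr => i _; rewrite big_ord1. Qed.

(** Taking marginals is adjoint to [oplus]; this links couplings with dual potentials. *)
Lemma mxdot_oplus (R : realType) (p q : nat) (P : 'M[R]_(p, q))
    (f : 'cV[R]_p) (g : 'cV[R]_q) :
  mxdot P (oplus f g) =
  dual_objective (P *m const_mx 1) (P^T *m const_mx 1) f g.
Proof.
rewrite /dual_objective !mxdot_cv /mxdot.
under eq_bigr do under eq_bigr do rewrite mxE mulrDr.
under eq_bigr do rewrite big_split.
rewrite big_split /= [X in _ + X]exchange_big /=.
congr (_ + _); apply: eq_bigr => i _; rewrite mxE mulr_sumr;
  by apply: eq_bigr => j _; rewrite !mxE mulr1 mulrC.
Qed.

Lemma weak_duality (R : realType) (p q : nat) (a : 'cV[R]_p) (b : 'cV[R]_q)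
    (C P : 'M[R]_(p, q)) (f : 'cV[R]_p) (g : 'cV[R]_q) :
  couplings a b P -> dual_feasible C f g -> dual_objective a b f g <= mxdot P C.
Proof.
move=> [P_ge0 <- <-] fgC; rewrite -mxdot_oplus.
apply: ler_sum => i _; apply: ler_sum => j _; apply: ler_wpM2l; last exact: fgC.
by have := P_ge0 i j; rewrite mxE.
Qed.

Lemma dual_objective_lin (R : realType) (p q : nat) (a : 'cV[R]_p)
    (b : 'cV[R]_q) :
  scalar (fun y : 'cV[R]_p * 'cV[R]_q => dual_objective a b y.1 y.2).
Proof.
move=> z [f g] [f' g']; rewrite /dual_objective !mxdot_cv /=.
under eq_bigr do rewrite !mxE mulrDl -mulrA.
rewrite big_split /= -mulr_sumr.
under [X in _ + X = _]eq_bigr do rewrite !mxE mulrDl -mulrA.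
rewrite big_split /= -mulr_sumr; ring.
Qed.

(** Meant for slacks [w] of finitely many constraints and their rates of change [d] along a
    direction: a short enough move stays feasible. *)
Lemma small_step (R : realFieldType) (I : finType) (d w : I -> R) :
  (forall i, 0 <= w i) -> (forall i, w i = 0 -> d i <= 0) ->
  exists2 e, 0 < e & forall i, e * d i <= w i.
Proof.
move=> w_ge0 wd.
(* The [+ 1] keeps the denominators positive, and the default 1 covers the case where every slack
   vanishes. *)
exists (\big[Num.min/1]_(i | w i != 0) (w i / (`|d i| + 1))).
  apply: (big_ind (fun e => 0 < e)) => // [x y x0 y0|i wi].
    by rewrite lt_min x0.
  by apply: divr_gt0; [rewrite lt0r wi w_ge0|rewrite ltr_wpDl].
move=> i; set e := \big[_/_]_(_ | _) _.
have e_ge0 : 0 <= e.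
  apply: (big_ind (fun e => 0 <= e)) => // [x y x0 y0|j wj].
    by rewrite le_min x0.
  by rewrite divr_ge0// addr_ge0.
have [wi|wi] := eqVneq (w i) 0.
  by rewrite wi mulr_ge0_le0// wd.
have d1_gt0 : 0 < `|d i| + 1 by rewrite ltr_wpDl.
have : e <= w i / (`|d i| + 1) by exact: bigmin_le_cond.
rewrite ler_pdivlMr//; apply: le_trans; rewrite ler_wpM2l//.
by rewrite (le_trans (ler_norm _))// lerDl.
Qed.

Lemma strong_duality (R : realType) (p q : nat) (a : 'cV[R]_p) (b : 'cV[R]_q)
    (C : 'M[R]_(p, q)) (f : 'cV[R]_p) (g : 'cV[R]_q) :
  dual_optimal a b C f g ->
  exists2 P, couplings a b P & mxdot P C = dual_objective a b f g.
Proof.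
move=> [fgC fg_opt].
pose W := ('cV[R]_p * 'cV[R]_q)%type.
pose A (ij : 'I_p * 'I_q) (y : W) : R := oplus y.1 y.2 ij.1 ij.2.
pose tight (ij : 'I_p * 'I_q) := C ij.1 ij.2 == A ij (f, g).
have A_lin ij : scalar (A ij).
  by move=> z [y1 y2] [y1' y2']; rewrite /A /= !mxE; ring.
have [[d e] d_le0|x [x_ge0 objE]] :=
    farkas (enum_uniq tight) A_lin (dual_objective_lin a b).
(* A step [eps] along [(d, e)] keeps [(f, g)] feasible, so optimality forces the objective of
   [(d, e)] to be nonpositive. *)
- have [ij|ij /eqP|eps eps_gt0 eps_le] :=
    @small_step R _ (A^~ (d, e)) (fun ij => C ij.1 ij.2 - A ij (f, g)).
  + by rewrite subr_ge0; exact: fgC.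
  + by rewrite subr_eq0 => tij; apply: d_le0; rewrite mem_enum.
  have : dual_feasible C (eps *: d + f) (eps *: e + g).
    move=> i j; have := eps_le (i, j); have := A_lin (i, j) eps (d, e) (f, g).
    rewrite /A /= => ->; lra.
  move=> /fg_opt; have := dual_objective_lin a b eps (d, e) (f, g).
  rewrite /= => ->; rewrite gerDr pmulr_rle0//.
pose P : 'M[R]_(p, q) := \matrix_(i, j) if tight (i, j) then x (i, j) else 0.
have {}objE f' g' : dual_objective a b f' g' = mxdot P (oplus f' g').
  rewrite (objE (f', g')) big_enum big_mkcond /mxdot pair_bigA /=.
  apply: eq_bigr => -[i j] _ /=; rewrite /P [(\matrix_(_, _) _) i j]mxE.
  by rewrite unfold_in -/(tight (i, j)); case: ifP; rewrite ?mul0r.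
exists P.
  (* Testing [objE] on unit vectors reads off the marginals of [P]. *)
  have deltaE r (z w : 'cV[R]_r) i : z = delta_mx i 0 -> mxdot z w = w i 0.
    move=> ->; rewrite mxdot_cv (bigD1 i)//= big1 => [|l li].
      by rewrite mxE !eqxx mul1r addr0.
    by rewrite mxE (negbTE li) mul0r.
  have dot0 r (w : 'cV[R]_r) : mxdot 0 w = 0.
    by rewrite mxdot_cv big1// => l _; rewrite mxE mul0r.
  split.
  - by move=> i j; rewrite !mxE; case: ifP.
  - apply/matrixP => i l; rewrite (ord1 l).
    have := objE (delta_mx i 0) 0.
    by rewrite mxdot_oplus /dual_objective !dot0 !addr0 !(deltaE _ _ _ i).
  - apply/matrixP => j l; rewrite (ord1 l).
    have := objE 0 (delta_mx j 0).
    by rewrite mxdot_oplus /dual_objective !dot0 !add0r !(deltaE _ _ _ j).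
(* Complementary slackness: [P] vanishes wherever [C] and [oplus f g] differ. *)
rewrite objE; apply: eq_bigr => i _; apply: eq_bigr => j _.
rewrite [P i j]mxE; case: ifP => [/eqP /= -> //|_]; by rewrite !mul0r.
Qed.

(** The coupling from [strong_duality] makes the set of costs nonempty and attains the lower bound
    from [weak_duality]. *)
Lemma OT_dual_optimal (R : realType) (p q : nat) (a : 'cV[R]_p) (b : 'cV[R]_q)
    (C : 'M[R]_(p, q)) (f : 'cV[R]_p) (g : 'cV[R]_q) :
  dual_optimal a b C f g -> OT a b C = dual_objective a b f g.
Proof.
move=> fg_opt; have [P PU PC] := strong_duality fg_opt.
have lb : lbound [set mxdot Q C | Q in couplings a b] (dual_objective a b f g).
  by move=> _ [Q QU <-]; apply: weak_duality => //; exact: fg_opt.1.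
apply/eqP; rewrite eq_le; apply/andP; split.
  by apply: ge_inf; [exists (dual_objective a b f g)|exists P].
by apply: lb_le_inf => //; exists (mxdot P C), P.
Qed.

(** * Splitting sums and pairings along batches *)

Section BatchSums.
Variables (R : realType) (N n k : nat) (B : 'I_k -> n.-tuple 'I_N).
Hypothesis B_part : batch_partition B.

Lemma sum_batch (F : 'I_N -> R) s :
  \sum_(i in B s) F i = \sum_j F (tnth (B s) j).
Proof. by have [uB _ _] := B_part; rewrite -big_uniq ?uB// big_tuple. Qed.

Lemma sum_batches (F : 'I_N -> R) :
  \sum_i F i = \sum_s \sum_j F (tnth (B s) j).
Proof.
have [_ dB cB] := B_part.
under [RHS]eq_bigr do rewrite -sum_batch big_mkcond.
rewrite exchange_big; apply: eq_bigr => i _; rewrite -big_mkcond /=.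
have [s si] := cB i; rewrite (big_pred1 s)// => t.
by apply/idP/eqP => [ti|->//]; exact: dB ti si.
Qed.

(** The shift [u s 0] is constant on its batch, so it is weighted by the batch mass; a nonzero mass
    cancels the normalization of [batch_weight]. *)
Lemma mxdot_blockwise (h : 'I_k -> 'cV[R]_n) (u : 'cV[R]_k) (a x : 'cV[R]_N) :
  (forall s, batch_mass B a s 0 != 0) ->
  blockwise B (fun s => h s + const_mx (u s 0)) x ->
  mxdot x a = mxdot u (batch_mass B a) +
    \sum_s batch_mass B a s 0 * mxdot (h s) (batch_weight B a s).
Proof.
move=> a_neq0 xE; rewrite !mxdot_cv sum_batches -big_split /=.
apply: eq_bigr => s _; rewrite mxdot_cv.
have mass_s : batch_mass B a s 0 = \sum_j a (tnth (B s) j) 0.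
  by rewrite mxE sum_batch.
rewrite [in u s 0 * _]mass_s !mulr_sumr -big_split /=.
apply: eq_bigr => j _.
have -> : x (tnth (B s) j) 0 = h s j 0 + u s 0.
  by have /matrixP/(_ j 0) := xE s; rewrite !mxE.
rewrite [batch_weight _ _ _ _ _]mxE [restrict _ _ _ _ _]mxE.
by rewrite [in RHS]mulrCA mulVKf// mulrDl addrC.
Qed.

End BatchSums.

(** * Feasibility and value of the assembled potentials *)

Lemma vmin_le (R : realType) (p : nat) (x : 'cV[R]_p.+1) i : vmin x <= x i 0.
Proof. exact: bigmin_le. Qed.

Lemma le_vmax (R : realType) (p : nat) (x : 'cV[R]_p.+1) i : x i 0 <= vmax x.
Proof. exact: (le_bigmax _ (fun i => x i 0)). Qed.

Theorem theoremA1 (R : realType) (n m k : nat)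
  (TX TY : Type) (c : TX -> TY -> R)
  (X : 'I_(n.+1 * k.+1) -> TX) (Y : 'I_(m.+1 * k.+1) -> TY)
  (a : 'cV[R]_(n.+1 * k.+1)) (b : 'cV[R]_(m.+1 * k.+1))
  (Bx : 'I_k.+1 -> n.+1.-tuple 'I_(n.+1 * k.+1))
  (By : 'I_k.+1 -> m.+1.-tuple 'I_(m.+1 * k.+1))
  (C := cost_matrix c X Y)
  (f : 'I_k.+1 -> 'I_k.+1 -> 'cV[R]_n.+1)
  (g : 'I_k.+1 -> 'I_k.+1 -> 'cV[R]_m.+1)
  (u v : 'cV[R]_k.+1)
  (ft : 'cV[R]_(n.+1 * k.+1)) (gt : 'cV[R]_(m.+1 * k.+1)) :
  simplex a -> simplex b ->
  batch_partition Bx -> batch_partition By ->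
  batch_mass Bx a = const_mx (k.+1%:R^-1) ->
  batch_mass By b = const_mx (k.+1%:R^-1) ->
  (forall s t, dual_optimal (batch_weight Bx a s) (batch_weight By b t)
                 (batch_cost Bx By C s t) (f s t) (g s t)) ->
  blockwise Bx (fun s => f s s + const_mx (u s 0)) ft ->
  blockwise By (fun t => g t t + const_mx (v t 0)) gt ->
  lemx (oplus u v) (gap_matrix f g) ->
  dual_feasible C ft gt /\
  dual_objective a b ft gt =
    mxdot u (batch_mass Bx a) + mxdot v (batch_mass By b) +
    \sum_s k.+1%:R^-1 *
      OT (batch_weight Bx a s) (batch_weight By b s) (batch_cost Bx By C s s).
Proof.
move=> _ _ Bx_part By_part a_mass b_mass fg_opt ftE gtE uvK; split.
  move=> i j; rewrite mxE.
  have [_ _ /(_ i)[s /tnthP[i' ->]]] := Bx_part.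
  have [_ _ /(_ j)[t /tnthP[j' ->]]] := By_part.
  have /matrixP/(_ i' 0) := ftE s; have /matrixP/(_ j' 0) := gtE t.
  rewrite !mxE => -> ->.
  (* Bounding the minimum and maximum in [gap_matrix] by the entries at [j'] and [i'] makes the
     differences telescope to [f s t] and [g s t], which are feasible for the batch pair. *)
  have := uvK s t; rewrite !mxE.
  have := vmin_le (g s t - g t t) j'; have := le_vmax (f s s - f s t) i'.
  rewrite !mxE; have := (fg_opt s t).1 i' j'; rewrite !mxE; lra.
have massx s : batch_mass Bx a s 0 = k.+1%:R^-1 by rewrite a_mass mxE.
have massy s : batch_mass By b s 0 = k.+1%:R^-1 by rewrite b_mass mxE.
rewrite {1}/dual_objective (mxdot_blockwise Bx_part _ ftE); last first.
  by move=> s; rewrite massx invr_eq0 pnatr_eq0.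
rewrite (mxdot_blockwise By_part _ gtE); last first.
  by move=> s; rewrite massy invr_eq0 pnatr_eq0.
(* Since both batch masses are [k.+1%:R^-1], the two block sums merge into multiples of the dual
   values of [(f s s, g s s)]. *)
rewrite addrACA; congr (_ + _); rewrite -big_split; apply: eq_bigr => s _ /=.
by rewrite massx massy -mulrDr (OT_dual_optimal (fg_opt s s)).
Qed.
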